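(* Let $0<\alpha$, $0<\beta$ with $\alpha+\beta\le\tfrac12$, $Z>0$ and $p_1\in[0,1]$, and put $\delta=\frac{1}{1-\alpha p_1}$. Assume the adversary mines honestly prior to $t=0$ and the blockchain adjusts difficulty at $t=0$, initiating a new (first) epoch. Under the Pay-Per-Share (PPS) scheme, if the adversary launches a classical block withholding (BWH) attack against a victim pool using fraction $p_1$ of its hashpower from $t=0$ onward, then the duration of the first epoch is $$t_1=\delta\tau_0=\frac{\tau_0}{1-\alpha p_1}.$$ At the end of this epoch the adversary's revenue change is $$\Delta_A(t_1)=-\delta\,\alpha p_1 2^{-Z}$$ (which is $\approx 0$ when $2^{-Z}\ll1$), the revenue changes of the honest miners in the victim pool and of the honest miners outside it are zero, $$\Delta_{H_P}(t_1)=\Delta_{H_R}(t_1)=0,$$ and the revenue change of the victim pool operator is $$\Delta_{Po}(t_1)=-\delta\,\alpha p_1(1-2^{-Z}).$$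
   Context: Model (all revenues, rates and epoch durations are expected values and are treated deterministically). The total network hashpower is normalized to $1$. The adversary ($A$) controls a fraction $\alpha$; the honest members of a victim pool ($H_P$) control $\beta$; the remaining honest miners ($H_R$) control $1-\alpha-\beta$. An epoch is the time needed to accumulate $D_0$ blocks on the chain; each block has coinbase reward $R_b=1/D_0$, so the total coinbase reward of an epoch is $1$. There are no forks: every published block is on the chain. At relative block difficulty $d$ (with $d=1$ for the epoch starting at $t=0$), hashpower $h$ finds full proofs-of-work (valid blocks, fPoW) at rate $hD_0/(d\tau_0)$, where $\tau_0$ is the target epoch duration; thus if everyone mines honestly at $d=1$, an epoch lasts $\tau_0$. At the end of an epoch of actual duration $\tau$, the difficulty is multiplied by $\tau_0/\tau$ (difficulty adjustment). PPS pool with fixed gap $Z$: the pool's share difficulty is $2^{-Z}$ times the current block difficulty. Hence hashpower $h$ finds valid shares at $2^{Z}$ times the rate at which it finds fPoWs, and a fraction $2^{-Z}$ of the shares are fPoWs. The pool operator ($Po$) immediately pays $R_b\cdot\frac{\text{share difficulty}}{\text{block difficulty}}=R_b2^{-Z}$ for every submitted share (whether or not it is an fPoW) and collects the coinbase reward of every block submitted to the pool. Pool fees are neglected. Attack: from $t=0$ on, the adversary uses hashpower $\alpha p_1$ in the victim pool, submitting all shares that are not fPoWs and never submitting (discarding, and not being paid for) any fPoW; it uses hashpower $\alpha(1-p_1)$ for honest solo mining, keeping the coinbase rewards. Honest pool members submit all their shares, including fPoWs; the remaining honest miners keep the coinbase rewards of the blocks they find. Revenue change: for each entity $x$, $\Delta_x(t)$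 is its total revenue over $[0,t]$ under the attack minus its total revenue over $[0,t]$ without attack. Without attack, a mining entity with hashpower fraction $f_x$ earns $f_x t/\tau_0$ and the pool operator has net revenue $0$. The operator's revenue is coinbase rewards collected minus PPS payments made. *)

(* Defs.v *)
(* Stdlib real numbers, with Coquelicot for series and limits. *)
From Stdlib Require Import Reals.
From Coquelicot Require Import Coquelicot.
Open Scope R_scope.

Inductive entity : Set :=
| Adversary     (* A *)
| PoolHonest    (* H_P *)
| OtherHonest   (* H_R *)
| PoolOperator. (* Po *)

Definition sum_entities (f : entity -> R) : R :=
  f Adversary + f PoolHonest + f OtherHonest + f PoolOperator.

(* The total hashpower of the network is 1. *)
Record bwh_attack : Set := BWHAttack {
  alpha : R;  (* hashpower of A *)
  beta : R;   (* hashpower of H_P *)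
  tau0 : R;   (* target epoch duration *)
  D0 : nat;   (* number of blocks in an epoch *)
  gap : R;    (* Z: share difficulty is 2^-Z times block difficulty *)
  p1 : R      (* fraction of the hashpower of A infiltrating the pool *)
}.

Definition block_reward (m : bwh_attack) : R := 1 / INR (D0 m).

(* In all rates below, [d] is the relative block difficulty and [h] a
   hashpower. *)
Definition fpow_rate (m : bwh_attack) (d h : R) : R :=
  h * INR (D0 m) / (d * tau0 m).

(* Valid shares, including those that are fPoWs; the latter are the fraction
   2^-Z of all shares, that is, they occur at rate [fpow_rate m d h]. *)
Definition share_rate (m : bwh_attack) (d h : R) : R :=
  Rpower 2 (gap m) * fpow_rate m d h.

Definition share_difficulty (m : bwh_attack) (d : R) : R :=
  Rpower 2 (- gap m) * d.

Definition share_payment (m : bwh_attack) (d : R) : R :=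
  block_reward m * (share_difficulty m d / d).

(* The adversary discards the fPoWs among its shares. *)
Definition share_submission_rate (m : bwh_attack) (d : R) (x : entity) : R :=
  match x with
  | Adversary =>
      share_rate m d (alpha m * p1 m)
      - Rpower 2 (- gap m) * share_rate m d (alpha m * p1 m)
  | PoolHonest => share_rate m d (beta m)
  | OtherHonest | PoolOperator => 0
  end.

Definition pool_block_rate (m : bwh_attack) (d : R) (x : entity) : R :=
  match x with
  | PoolHonest => fpow_rate m d (beta m)
  | Adversary | OtherHonest | PoolOperator => 0
  end.

Definition solo_block_rate (m : bwh_attack) (d : R) (x : entity) : R :=
  match x with
  | Adversary => fpow_rate m d (alpha m * (1 - p1 m))
  | OtherHonest => fpow_rate m d (1 - alpha m - beta m)
  | PoolHonest | PoolOperator => 0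
  end.

Definition chain_rate (m : bwh_attack) (d : R) : R :=
  sum_entities (fun x => pool_block_rate m d x + solo_block_rate m d x).

Definition revenue_rate (m : bwh_attack) (d : R) (x : entity) : R :=
  match x with
  | PoolOperator =>
      block_reward m * sum_entities (pool_block_rate m d)
      - share_payment m d * sum_entities (share_submission_rate m d)
  | Adversary | PoolHonest | OtherHonest =>
      share_payment m d * share_submission_rate m d x
      + block_reward m * solo_block_rate m d x
  end.

Definition epoch_duration (m : bwh_attack) (d : R) : R :=
  INR (D0 m) / chain_rate m d.

(* Epochs are numbered from 0, the epoch starting at time 0.  Its relative
   difficulty is 1: an epoch mined honestly by everyone at any difficulty d
   lasts d * tau0, and the adjustment at its end multiplies d by 1 / d. *)
Fixpoint difficulty (m : bwh_attack) (k : nat) : R :=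
  match k with
  | O => 1
  | S k' =>
      difficulty m k' * (tau0 m / epoch_duration m (difficulty m k'))
  end.

Fixpoint epoch_start (m : bwh_attack) (k : nat) : R :=
  match k with
  | O => 0
  | S k' => epoch_start m k' + epoch_duration m (difficulty m k')
  end.

(* Length of the part of the k-th epoch lying in [0, t]. *)
Definition time_in_epoch (m : bwh_attack) (t : R) (k : nat) : R :=
  Rmin t (epoch_start m (S k)) - Rmin t (epoch_start m k).

Definition revenue (m : bwh_attack) (x : entity) (t : R) : R :=
  Series (fun k => revenue_rate m (difficulty m k) x * time_in_epoch m t k).

Definition revenue_without_attack (m : bwh_attack) (x : entity) (t : R) : R :=
  match x with
  | Adversary => alpha m * t / tau0 m
  | PoolHonest => beta m * t / tau0 m
  | OtherHonest => (1 - alpha m - beta m) * t / tau0 m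
  | PoolOperator => 0
  end.

Definition revenue_change (m : bwh_attack) (x : entity) (t : R) : R :=
  revenue m x t - revenue_without_attack m x t.

(* Main.v *)
(* The chain grows at rate (1 - alpha p1) D0 / tau0 in the first epoch, because
   exactly the adversary's infiltrating fPoWs are missing; hence the factor
   delta in t1.  Everybody's revenue rate is constant during that epoch.  The
   honest rates equal those without attack, and the adversary loses precisely
   the payments for its discarded shares, a fraction 2^-Z of the infiltrating
   hashpower.  The operator pays for the other shares of the adversary without
   collecting any of the corresponding blocks. *)
Require Import Defs.
From Stdlib Require Import Reals Lra.
From Coquelicot Require Import Coquelicot.
Open Scope R_scope.

(** [Series] is a limit of partial sums, so convergence has to be shown: the tail after [a O] has
    all partial sums 0. *)
Lemma Series_eq_first (a : nat -> R) :
  (forall k, a (S k) = 0) -> Series a = a O.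
Proof.
intros Ha.
apply is_series_unique, is_series_decr_1.
apply is_series_ext with (fun _ => 0); [intros k; now rewrite Ha|].
change (is_lim_seq (sum_n (fun _ => 0)) (a O - a O)); rewrite Rminus_diag.
apply is_lim_seq_ext with (fun _ => 0); [|apply is_lim_seq_const].
intros n; rewrite sum_n_const; ring.
Qed.

Lemma is_lim_Rpower_opp_p_infty (b : R) :
  1 < b -> is_lim (fun z => Rpower b (- z)) p_infty 0.
Proof.
intros Hb.
assert (Hln : 0 < ln b) by (rewrite <- ln_1; apply ln_increasing; lra).
unfold Rpower.
apply is_lim_comp with m_infty; [apply is_lim_exp_m| |now exists 0].
apply is_lim_ext with (fun z => (- ln b) * z); [intros z; ring|].
evar_last; [apply is_lim_scal_l, is_lim_id|].
(* The product of a real and [p_infty] is defined by cases on the sign of the real; here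
   [- ln b < 0] yields [m_infty]. *)
simpl; destruct (Rle_dec 0 (- ln b)) as [H|H]; [exfalso; lra|reflexivity].
Qed.

Lemma infiltration_lt_1 (a b p : R) :
  0 < a -> 0 < b -> a + b <= 1 / 2 -> 0 <= p <= 1 -> 0 < 1 - a * p.
Proof. intros; nra. Qed.

Section Attack.
Variable m : bwh_attack.
Hypothesis tau0_gt0 : 0 < tau0 m.
Hypothesis D0_gt0 : (0 < D0 m)%nat.
Hypothesis infiltration_lt1 : 0 < 1 - alpha m * p1 m.

Let INR_D0_gt0 : 0 < INR (D0 m) := lt_0_INR _ D0_gt0.

Lemma epoch_durationE (d : R) :
  d <> 0 -> epoch_duration m d = d * tau0 m / (1 - alpha m * p1 m).
Proof.
intros Hd.
(* The hashpowers whose blocks reach the chain, [beta], [alpha * (1 - p1)] and [1 - alpha - beta],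
   add up to [1 - alpha * p1]. *)
assert (Hrate : chain_rate m d
  = (1 - alpha m * p1 m) * INR (D0 m) / (d * tau0 m)).
{ unfold chain_rate, sum_entities, pool_block_rate, solo_block_rate, fpow_rate.
  field; lra. }
unfold epoch_duration; rewrite Hrate.
field; lra.
Qed.

Lemma epoch_duration_gt0 (d : R) : 0 < d -> 0 < epoch_duration m d.
Proof.
intros Hd; rewrite epoch_durationE by lra.
apply Rdiv_lt_0_compat; [now apply Rmult_lt_0_compat|assumption].
Qed.

Lemma difficulty_gt0 (k : nat) : 0 < difficulty m k.
Proof.
induction k as [|k IH]; simpl; [lra|].
apply Rmult_lt_0_compat; [assumption|].
apply Rdiv_lt_0_compat; [assumption|now apply epoch_duration_gt0].
Qed.

Lemma epoch_start_1 : epoch_start m 1 = epoch_duration m (difficulty m 0).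
Proof. simpl; ring. Qed.

(** Every epoch has positive length. This makes all epochs after the first contribute nothing to the
    revenue up to [t1]. *)
Lemma epoch_start_1_le (k : nat) : epoch_start m 1 <= epoch_start m (S k).
Proof.
induction k as [|k IH]; [lra|].
change (epoch_start m (S (S k))) with
  (epoch_start m (S k) + epoch_duration m (difficulty m (S k))).
pose proof (epoch_duration_gt0 _ (difficulty_gt0 (S k))); lra.
Qed.

Lemma revenue_first_epoch (x : entity) :
  revenue m x (epoch_duration m 1)
    = revenue_rate m 1 x * (tau0 m / (1 - alpha m * p1 m)).
Proof.
assert (H1 : epoch_duration m 1 = epoch_start m 1)
  by (rewrite epoch_start_1; reflexivity).
unfold revenue; rewrite Series_eq_first.
- unfold time_in_epoch.
  rewrite <- H1, Rmin_left by lra.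
  rewrite Rmin_right
    by (simpl; apply Rlt_le, epoch_duration_gt0; lra).
  rewrite epoch_durationE by lra; simpl; f_equal; field; lra.
(* For later epochs both minima are the end of the first epoch, so their difference vanishes. *)
- intros k; unfold time_in_epoch; rewrite H1.
  rewrite !Rmin_left by apply epoch_start_1_le; ring.
Qed.

Lemma revenue_change_first_epoch (x : entity) :
  revenue_change m x (epoch_duration m 1)
    = match x with
      | Adversary =>
          - (1 / (1 - alpha m * p1 m)) * (alpha m * p1 m) * Rpower 2 (- gap m)
      | PoolHonest | OtherHonest => 0
      | PoolOperator =>
          - (1 / (1 - alpha m * p1 m)) * (alpha m * p1 m)
            * (1 - Rpower 2 (- gap m))
      end.
Proof.
(* Once 2^-Z is rewritten as the inverse of 2^Z, [field] needs 2^Z to be nonzero. *)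
assert (Hpos : 0 < Rpower 2 (gap m)) by apply exp_pos.
unfold revenue_change; rewrite revenue_first_epoch, epoch_durationE by lra.
destruct x; unfold revenue_rate, revenue_without_attack, sum_entities,
  share_payment, share_submission_rate, share_difficulty, share_rate,
  pool_block_rate, solo_block_rate, block_reward, fpow_rate;
  rewrite ?Rpower_Ropp; field; repeat split; lra.
Qed.

End Attack.

Theorem lemma1 (alpha beta tau0 Z p1 : R) (D0 : nat)
  (halpha : 0 < alpha) (hbeta : 0 < beta) (hab : alpha + beta <= 1 / 2)
  (hZ : 0 < Z) (hp1 : 0 <= p1 <= 1) (htau0 : 0 < tau0) (hD0 : (0 < D0)%nat) :
  let delta := 1 / (1 - alpha * p1) in
  let attack (z : R) := BWHAttack alpha beta tau0 D0 z p1 in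
  let m := attack Z in
  let t1 := epoch_duration m (difficulty m 0) in
  (t1 = delta * tau0 /\ t1 = tau0 / (1 - alpha * p1)) /\
  (revenue_change m Adversary t1 = - delta * (alpha * p1) * Rpower 2 (- Z) /\
   is_lim (fun z =>
     let t1z := epoch_duration (attack z) (difficulty (attack z) 0) in
     revenue_change (attack z) Adversary t1z) p_infty 0) /\
  (revenue_change m PoolHonest t1 = 0 /\
   revenue_change m OtherHonest t1 = 0) /\
  revenue_change m PoolOperator t1
    = - delta * (alpha * p1) * (1 - Rpower 2 (- Z)).
Proof.
intros delta attack m t1.
assert (Hinf : 0 < 1 - alpha * p1) by (apply infiltration_lt_1 with beta; assumption).
(* The gap stays variable because the approximation claim is a limit in [z]; [delta] does not depend
   on it. *)
assert (Hchange := fun z => revenue_change_first_epoch (attack z) htau0 hD0 Hinf).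
assert (Ht1 : t1 = tau0 / (1 - alpha * p1)).
{ unfold t1; simpl difficulty.
  rewrite epoch_durationE by (assumption || lra); simpl; field; lra. }
repeat split.
- rewrite Ht1; unfold delta; field; lra.
- exact Ht1.
- exact (Hchange Z Adversary).
- apply is_lim_ext with
    (fun z => (- delta * (alpha * p1)) * Rpower 2 (- z)).
  { intros z; symmetry; exact (Hchange z Adversary). }
  evar_last; [apply is_lim_scal_l, is_lim_Rpower_opp_p_infty; lra|].
  simpl; f_equal; ring.
- exact (Hchange Z PoolHonest).
- exact (Hchange Z OtherHonest).
- exact (Hchange Z PoolOperator).
Qed.
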